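(* Let $q=1+3a^2$ be a prime power, with $a$ an integer, such that $2$ is a cubic residue in $\mathbb{F}_q$. Let $\gamma$ be a primitive element of $\mathbb{F}_q$, $l=\frac{q-1}{6}$, and let $G$ be the group on $\mathbb{F}_q\times\mathbb{Z}_l$ with multiplication $(x,i)(y,j)=(x+\gamma^{6i}y,\ i+j)$. Let $S=\{-1+x: x\in D_3^6\}$ and $E=\{(x,i): x\in S,\ i\in\mathbb{Z}_l\}$. Then $\mathrm{Cay}(G,E)$ is a directed strongly regular graph with parameters $\left(\frac{q(q-1)}{6},\ \left(\frac{q-1}{6}\right)^2,\ \frac{(q-1)^2}{216},\ \frac{(q-1)^2}{216}-\frac{q-1}{36},\ \frac{(q-1)^2}{216}\right)$.
   Context: The cyclotomic classes of order $e$ (for $e\mid q-1$) with respect to $\gamma$ are $D_i^e=\gamma^i\langle\gamma^e\rangle$, $i=0,\dots,e-1$. ''2 is a cubic residue'' means $2=z^3$ for some $z\in\mathbb{F}_q^*$. The Cayley digraph $\mathrm{Cay}(G,E)$ has vertex set $G$ and an arc $g\to h$ iff $g^{-1}h\in E$. A directed strongly regular graph with parameters $(v,k,t,\lambda,\mu)$ is a digraph (no loops, no multiple arcs) on $v$ vertices whose adjacency matrix $A$ satisfies $A^2=tI+\lambda A+\mu(J-I-A)$ and $AJ=JA=kJ$. *)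

(* Defs.v *)
From HB Require Import structures.
From mathcomp Require Import all_boot all_order all_algebra all_field.
Set Implicit Arguments. Unset Strict Implicit. Unset Printing Implicit Defensive.
Import GRing.Theory Num.Theory.
Local Open Scope ring_scope.

Definition ell (F : finFieldType) : nat := (#|F|.-1 %/ 6)%N.

Lemma ord_pos (n : nat) (i : 'I_n) : (0 < n)%N.
Proof. exact: leq_ltn_trans (leq0n i) (ltn_ord i). Qed.

Definition ord_add (n : nat) (i j : 'I_n) : 'I_n :=
  Ordinal (ltn_pmod (i + j) (ord_pos i)).
Definition ord_opp (n : nat) (i : 'I_n) : 'I_n :=
  Ordinal (ltn_pmod (n - i) (ord_pos i)).

Definition Gmul (F : finFieldType) (gamma : F) (g h : F * 'I_(ell F)) :
  F * 'I_(ell F) :=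
  (g.1 + gamma ^+ (6 * g.2) * h.1, ord_add g.2 h.2).
Definition Ginv (F : finFieldType) (gamma : F) (g : F * 'I_(ell F)) :
  F * 'I_(ell F) :=
  (- (gamma ^+ (6 * g.2))^-1 * g.1, ord_opp g.2).

Definition cyc_class (F : finFieldType) (gamma : F) (e i : nat) : {set F} :=
  [set gamma ^+ i * (gamma ^+ e) ^+ m | m : 'I_#|F|].

Definition Sset (F : finFieldType) (gamma : F) : {set F} :=
  [set -1 + x | x in cyc_class gamma 6 3].

Definition Eset (F : finFieldType) (gamma : F) : {set F * 'I_(ell F)} :=
  [set g | g.1 \in Sset gamma].

Definition cay_arc (F : finFieldType) (gamma : F) (g h : F * 'I_(ell F)) : bool :=
  Gmul gamma (Ginv gamma g) h \in Eset gamma.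

Definition adjmx (V : finType) (adj : rel V) : 'M[rat]_#|V| :=
  \matrix_(i, j) (adj (enum_val i) (enum_val j))%:R.

Definition is_dsrg (V : finType) (adj : rel V) (v k t lam mu : rat) : Prop :=
  let A := adjmx adj in
  let J := const_mx 1 : 'M[rat]_#|V| in
  [/\ (#|V|%:R = v),
      (forall x, ~~ adj x x),
      A *m A = t%:M + lam *: A + mu *: (J - 1%:M - A),
      A *m J = k *: J &
      J *m A = k *: J].

(* Main.v *)
Require Import Defs.
From HB Require Import structures.
From mathcomp Require Import all_boot all_order all_algebra all_field.
From mathcomp Require Import zify ring lra.
Set Implicit Arguments. Unset Strict Implicit. Unset Printing Implicit Defensive.

(** Write [q = 6 l + 1]; then [l] is even, so [-1] lies in [D_0].  Counting
    2-paths shows that the theorem follows once the cyclotomic numbers [(3, i)]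
    of order 6 are all equal to [l / 6]: the set [S] meets every class equally.

    Substituting [x -> 1 - x], [x -> 1 / x] and [y = 2 x - 1] in the counts of
    [x] with [x (1 - x)] in a given class (the last one uses that 4 is in
    [D_0]) yields linear relations that leave one unknown, the real part [c]
    of the cubic Jacobi sum [J = c + d sqrt(-3)]; the wanted equalities amount
    to [c = -1].  One has [c = -1 mod 3] and [c^2 + 3 d^2 = q = 1 + 3 a^2].

    Let [q = p^n].  If [p = 1 mod 3], then [p] does not divide [J], because
    [J] reduces to [- C(2k, k)], [k = (q - 1) / 3], at one of the primes
    above [p]; hence the two representations of [q] coincide up to signs.
    If [p = 2 mod 3], then [n] is even and [p^n = 1 + 3 a^2] is impossible by
    infinite descent. *)

(** * Coprime factors of squares, and squares modulo 3, 4 and 8 *)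

Lemma coprime_mul_sqr a b m : coprime a b -> a * b = m ^ 2 ->
  exists x y, [/\ a = x ^ 2, b = y ^ 2 & x * y = m].
Proof.
have root c d : coprime c d -> c * d = m ^ 2 -> c = gcdn c m ^ 2.
  (* Distributing gives [gcd(c, m)^2 = c * gcd(gcd(c, m), gcd(m, d))], and the last factor is 1
     because [c] and [d] are coprime. *)
  move=> cop cdE; rewrite -mulnn muln_gcdr !muln_gcdl [m * m]mulnn -cdE.
  rewrite [m * c]mulnC -!muln_gcdr gcdnA -gcdnA.
  suff /eqP-> : gcdn (gcdn c m) (gcdn m d) == 1 by rewrite muln1.
  apply: coprime_dvdl (dvdn_gcdl _ _) _.
  exact: coprime_dvdr (dvdn_gcdr _ _) cop.
move=> cop abE; have aE := root _ _ cop abE.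
have bE : b = gcdn b m ^ 2.
  by apply: (root b a); rewrite ?[b * a]mulnC // coprime_sym.
exists (gcdn a m), (gcdn b m); split=> //.
by apply/eqP; rewrite -(eqn_exp2r _ _ (isT : 0 < 2)) expnMn -aE -bE abE.
Qed.

Lemma coprime_mul_prime_sqr p a b m : prime p -> coprime a b ->
    a * b = p * m ^ 2 ->
  exists x y, (a = p * x ^ 2 /\ b = y ^ 2) \/ (a = x ^ 2 /\ b = p * y ^ 2).
Proof.
move=> p_pr cop abE; have p_gt0 := prime_gt0 p_pr.
have: p %| a * b by rewrite abE dvdn_mulr.
rewrite Euclid_dvdM // => /orP[] /dvdnP[c cE]; rewrite {}cE in cop abE *.
- have copc : coprime c b by move: cop; rewrite coprimeMl => /andP[].
  have [|x [y [-> -> _]]] := @coprime_mul_sqr c b m copc; last first.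
    by exists x, y; left; rewrite mulnC.
  by apply/eqP; rewrite -(eqn_pmul2l p_gt0) -abE; apply/eqP; ring.
- have copc : coprime a c by move: cop; rewrite coprimeMr => /andP[].
  have [|x [y [-> -> _]]] := @coprime_mul_sqr a c m copc; last first.
    by exists x, y; right; rewrite [p * _]mulnC.
  by apply/eqP; rewrite -(eqn_pmul2l p_gt0) -abE; apply/eqP; ring.
Qed.

Lemma odd_sqr_mod8 n : odd n -> exists k, n ^ 2 = 8 * k + 1.
Proof.
move=> n_odd; have [m ->] : exists m, n = 2 * m + 1 by exists n./2; lia.
have [k kE] : exists k, m * m.+1 = 2 * k.
  by exists (m * m.+1)./2; have := oddM m m.+1; rewrite /= andbN; lia.
by exists k; nia.
Qed.

Lemma even_sqr_mod4 n : ~~ odd n -> exists k, n ^ 2 = 4 * k.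
Proof.
move=> n_even; exists (n./2 ^ 2).
by rewrite -{1}(odd_double_half n) (negPf n_even); lia.
Qed.

Lemma sqr_mod3 n : exists k, n ^ 2 = 3 * k \/ n ^ 2 = 3 * k + 1.
Proof.
exists (n ^ 2 %/ 3); have := modnXm 2 3 n; have := ltn_pmod n (isT : 0 < 3).
by move: (n ^ 2) => N; case: (n %% 3) => [|[|[|]]] // _; lia.
Qed.

(** * Descent excluding p^n = 1 + 3 a^2 for n even and p odd, p = 2 mod 3 *)

Lemma no_hypot_2sqr_3sqr x y v :
  2 * y ^ 2 + 1 = 3 * x ^ 2 -> v ^ 2 = (2 * y ^ 2) ^ 2 + (3 * x ^ 2) ^ 2 ->
  0 < y -> False.
Proof.
move=> xyE vE y_gt0.
have x_odd : odd x.
  by have : odd (3 * x ^ 2); [rewrite -xyE; lia | rewrite oddM oddX].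
have cop : coprime (2 * y ^ 2) (3 * x ^ 2) by rewrite -xyE addn1 coprimenS.
have copy : coprime (y ^ 2) (3 * x ^ 2).
  by move: cop; rewrite coprimeMl => /andP[].
have [X XE] := odd_sqr_mod8 x_odd.
have v_odd : odd v.
  by have := congr1 odd vE; rewrite !(oddD, oddM, oddX) x_odd.
have lt_v : 3 * x ^ 2 < v.
  rewrite -(ltn_exp2r _ _ (isT : 0 < 2)) vE -[X in X < _]add0n ltn_add2r.
  by rewrite expn_gt0 muln_gt0 expn_gt0 y_gt0.
(* Writing the hypotenuse as [3 x^2 + 2 e] turns the Pythagorean equation into [e (e + 3 x^2) = y^4]
   with coprime factors, so that [e = al^4] and [e + 3 x^2 = be^4]. *)
have [e eE] : exists e, v = 3 * x ^ 2 + 2 * e.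
  by exists ((v - 3 * x ^ 2)./2); lia.
have emE : e * (e + 3 * x ^ 2) = (y ^ 2) ^ 2.
  by move: vE; rewrite eE; move: (3 * x ^ 2) (y ^ 2) => s t; lia.
have cope : coprime e (e + 3 * x ^ 2).
  rewrite /coprime gcdnDl; apply: (@coprime_dvdl _ ((y ^ 2) ^ 2)).
    by rewrite -emE dvdn_mulr.
  exact: coprimeXl.
have [A [B [AE BE ABE]]] := coprime_mul_sqr cope emE.
have copAB : coprime A B.
  by move: cope; rewrite BE AE coprime_pexpl // coprime_pexpr.
have [al [be [alE beE albeE]]] := coprime_mul_sqr copAB ABE.

have al_y : al ^ 2 %| y ^ 2 by rewrite -alE -ABE dvdn_mulr.
have lt_albe : al ^ 2 < be ^ 2.
  rewrite -(ltn_exp2r _ _ (isT : 0 < 2)) -alE -beE -AE -BE.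
  by rewrite -[X in X < _]addn0 ltn_add2l muln_gt0 expn_gt0 (odd_gt0 x_odd).
(* Now [3 x^2 = (be^2 - al^2) (be^2 + al^2)] with coprime factors; [f] is the first one, and one of
   the two is a square, the other 3 times a square. *)
have [f fE] : exists f, be ^ 2 = al ^ 2 + f.
  by exists (be ^ 2 - al ^ 2); rewrite subnKC // ltnW.
have fmE : f * (f + 2 * al ^ 2) = 3 * x ^ 2.
  move: BE; rewrite AE alE beE fE; clear.
  by move: (3 * x ^ 2) (al ^ 2) => s t; lia.
have f_x : f %| 3 * x ^ 2 by rewrite -fmE dvdn_mulr.
have copf : coprime f (f + 2 * al ^ 2).
  rewrite /coprime gcdnDl -/(coprime _ _) coprimeMr; apply/andP; split.
    by rewrite coprimen2; apply: dvdn_odd f_x _; rewrite oddM oddX.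
  apply: coprime_dvdl f_x _; rewrite coprime_sym.
  exact: coprime_dvdl al_y copy.
have [h [g [[fE' gE]|[fE' gE]]]] :=
  coprime_mul_prime_sqr (isT : prime 3) copf fmE.
(* Here [g^2 = 3 h^2 + 2 al^2] with [g] and [h] odd, which fails modulo 8. *)
- have g_odd : odd g.
    have : odd (g ^ 2); last by rewrite oddX.
    by apply: (@dvdn_odd _ (3 * x ^ 2)); [rewrite -fmE -gE dvdn_mull | rewrite oddM oddX].
  have h_odd : odd h.
    have : odd (3 * h ^ 2); last by rewrite oddM oddX.
    by rewrite -fE'; apply: dvdn_odd f_x _; rewrite oddM oddX.
  have [kg kgE] := odd_sqr_mod8 g_odd; have [kh khE] := odd_sqr_mod8 h_odd.
  by have [/odd_sqr_mod8[ka]|/even_sqr_mod4[ka]] := boolP (odd al);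
    move: fE fE' gE kgE khE; clear; move: (al ^ 2) (be ^ 2) (g ^ 2) (h ^ 2); lia.
(* Here [al^2 + be^2 = 3 g^2] forces 3 to divide [al], hence [y], against the coprimality of [y^2]
   and [3 x^2]. *)
- have : ~~ (3 %| al ^ 2).
    rewrite -prime_coprime // coprime_sym; apply: coprime_dvdl al_y _.
    by move: copy; rewrite coprimeMr => /andP[].
  have [ka kaE] := sqr_mod3 al; have [kb kbE] := sqr_mod3 be.
  by move: fE gE kaE kbE; clear; move: (al ^ 2) (be ^ 2) (g ^ 2); lia.
Qed.

(** With [r = 2 h + 1] and [u = 2 w] the equations become [h (h + 1) = 6 w^2] and
    [v^2 = h^2 + (h + 1)^2]. Of the four ways to split 6 between the coprime factors [h] and
    [h + 1], two fail modulo 3, [h = 2 y^2] with [h + 1 = 3 x^2] is excluded by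
    [no_hypot_2sqr_3sqr], and [h = 6 x^2] with [h + 1 = y^2] is the conclusion. *)
Lemma pell_pair_12sqr r u v : odd r -> 1 < r ->
    r ^ 2 = 6 * u ^ 2 + 1 -> r ^ 2 + 1 = 2 * v ^ 2 ->
  exists x y, r = 12 * x ^ 2 + 1 /\ r + 1 = 2 * y ^ 2.
Proof.
move=> r_odd r_gt1 uE vE.
have [h hE] : exists h, r = 2 * h + 1 by exists r./2; lia.
have u_even : ~~ odd u.
  have : 3 * u ^ 2 = 2 * (h * h.+1) by nia.
  by move/(congr1 odd); rewrite !(oddX, oddM) /= => ->.
have [w wE] : exists w, u = 2 * w by exists u./2; lia.
have hwE : h * h.+1 = 6 * w ^ 2 by nia.
have vhE : v ^ 2 = h ^ 2 + h.+1 ^ 2 by nia.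
have cop := coprimenS h.
have : 3 %| h * h.+1 by rewrite hwE; lia.
rewrite Euclid_dvdM // => /orP[] /dvdnP[c cE].
- have copc : coprime c h.+1 by move: cop; rewrite {1}cE coprimeMl => /andP[].
  have cwE : c * h.+1 = 2 * w ^ 2 by nia.
  have [x [y [[xE yE]|[xE yE]]]] :=
    coprime_mul_prime_sqr (isT : prime 2) copc cwE.
    by exists x, y; lia.
  have [k kE] := sqr_mod3 y; move: cE yE kE; clear; move: (y ^ 2); lia.
- have copc : coprime h c by move: cop; rewrite {1}cE coprimeMr => /andP[].
  have cwE : h * c = 2 * w ^ 2 by nia.
  have [y [x [[yE xE]|[yE xE]]]] :=
    coprime_mul_prime_sqr (isT : prime 2) copc cwE.
    case: (@no_hypot_2sqr_3sqr x y v); rewrite -?yE;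
      last by case: y yE => //; lia.
      by lia.
    by rewrite vhE; congr (_ + _ ^ 2); lia.
  have [k kE] := sqr_mod3 y; move: cE yE kE; clear; move: (y ^ 2); lia.
Qed.

(** With [t = 2 h + 1] one has [h (h + 1) = 3 x^2]; the split [h = X^2], [h + 1 = 3 Y^2] fails
    modulo 3. *)
Lemma sqr_12sqr_6sqr t x : odd t -> t ^ 2 = 12 * x ^ 2 + 1 ->
  exists X Y, t = 6 * X ^ 2 + 1 /\ t + 1 = 2 * Y ^ 2.
Proof.
move=> t_odd tE.
have [h hE] : exists h, t = 2 * h + 1 by exists t./2; lia.
have hxE : h * h.+1 = 3 * x ^ 2 by nia.
have [X [Y [[XE YE]|[XE YE]]]] :=
  coprime_mul_prime_sqr (isT : prime 3) (coprimenS h) hxE.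
  by exists X, Y; lia.
have [k kE] := sqr_mod3 X; move: XE YE kE; clear; move: (X ^ 2) (Y ^ 2); lia.
Qed.

Lemma expn_mod3 p j : p %% 3 = 2 -> (p ^ j) %% 3 = if odd j then 2 else 1.
Proof.
move=> pE; elim: j => // j IH.
by rewrite expnS -modnMm pE IH /=; case: (odd j).
Qed.

(* [p ^ j = 2 mod 3] is excluded by [pell_pair_12sqr]; otherwise [4] divides [j]
   and [p ^ (j / 4)] is again a solution. *)
Lemma pell_pair_expn_false p j u v : odd p -> p %% 3 = 2 -> 0 < j ->
  (p ^ j) ^ 2 = 6 * u ^ 2 + 1 -> (p ^ j) ^ 2 + 1 = 2 * v ^ 2 -> False.
Proof.
move=> p_odd pE; have p_gt1 : 1 < p by lia.
elim/ltn_ind: j u v => j IH u v j_gt0 uE vE.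
have gt1 i : 0 < i -> 1 < p ^ i by move=> ?; rewrite -(exp1n i) ltn_exp2r.
have odd_pX i : odd (p ^ i) by rewrite oddX p_odd orbT.
have [x [y [xE yE]]] := pell_pair_12sqr (odd_pX j) (gt1 j j_gt0) uE vE.
have j_even : ~~ odd j by have := expn_mod3 j pE; case: odd; lia.
have [i iE] : exists i, j = i * 2 by exists j./2; lia.
rewrite iE expnM in xE yE.
have [X [Y [XE YE]]] := sqr_12sqr_6sqr (odd_pX i) xE.
have i_even : ~~ odd i by have := expn_mod3 i pE; case: odd; lia.
have [k kE] : exists k, i = k * 2 by exists i./2; lia.
rewrite kE expnM in XE YE.
by apply: (IH k _ X Y) XE YE; lia.
Qed.

(** Since [a] is even, [sqr_12sqr_6sqr] applies to [p^m] and gives [p^m = 6 X^2 + 1] and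
    [p^m + 1 = 2 Y^2]. The first equation makes [m] even, so [p^(m/2)] solves the pair of equations
    of [pell_pair_expn_false]. *)
Lemma even_exp_neq_1_3sqr p m a : odd p -> p %% 3 = 2 -> 0 < m ->
  (p ^ m) ^ 2 <> 3 * a ^ 2 + 1.
Proof.
move=> p_odd pE m_gt0 aE; have s_odd : odd (p ^ m) by rewrite oddX p_odd orbT.
have a_even : ~~ odd a.
  have := congr1 odd aE; rewrite !(oddD, oddM, oddX) p_odd orbT /=.
  by case: (odd a).
have [b bE] : exists b, a = 2 * b by exists a./2; lia.
have bsE : (p ^ m) ^ 2 = 12 * b ^ 2 + 1 by rewrite aE bE; lia.
have [X [Y [XE YE]]] := sqr_12sqr_6sqr s_odd bsE.
have m_even : ~~ odd m by have := expn_mod3 m pE; case: odd; lia.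
have [k kE] : exists k, m = k * 2 by exists m./2; lia.
rewrite kE expnM in XE YE.
by apply: (@pell_pair_expn_false p k X Y) => //; lia.
Qed.

(** * A central binomial coefficient modulo p, and representations by c^2 + 3 d^2 *)

Lemma central_bin_coprime p n k : prime p -> p %% 3 = 1 ->
  (3 * k).+1 = p ^ n -> ~~ (p %| 'C(2 * k, k)).
Proof.
move=> p_pr pE kE.
have bin_gt0 : 0 < 'C(2 * k, k) by rewrite bin_gt0; lia.
have mod1 i : (p ^ i) %% 3 = 1 by rewrite -modnXm pE exp1n.
(* By Legendre's formula, [p] does not divide [C(2k, k)] if doubling [k] in base [p] produces no
   carry, which is the condition stated here. For [i <= n] it holds because all base [p] digits of
   [k] are [(p - 1) / 3], so that [k] is [(p^i - 1) / 3] modulo [p^i]. *)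
have half_mod i : 2 * (k %% p ^ i) < p ^ i.
  have [le_in|lt_ni] := leqP i n; last first.
    have : p ^ n <= p ^ i by rewrite leq_exp2l ?prime_gt1 // ltnW.
    by have := leq_mod k (p ^ i); lia.
  have -> : k = (p ^ (n - i) %/ 3) * p ^ i + p ^ i %/ 3.
    have e1 := divn_eq (p ^ (n - i)) 3; have e2 := divn_eq (p ^ i) 3.
    have e3 : p ^ n = p ^ (n - i) * p ^ i by rewrite -expnD subnK.
    rewrite !mod1 in e1 e2; move: kE e1 e2; rewrite e3.
    move: (p ^ (n - i)) (p ^ i) => A B; move: (A %/ 3) (B %/ 3) => C D; nia.
  rewrite modnMDl modn_small; last by rewrite ltn_Pdiv // expn_gt0 prime_gt0.
  by have := mod1 i; lia.
suff: logn p 'C(2 * k, k) = 0.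
  by move=> l0; apply/negP; rewrite -[p in p %| _]expn1 pfactor_dvdn // l0.
have := bin_fact (_ : k <= 2 * k); rewrite (_ : 2 * k - k = k); last by lia.
move/(_ ltac:(lia))/(congr1 (logn p)).
rewrite !lognM ?muln_gt0 ?fact_gt0 // !logn_fact //.
rewrite [in RHS](@big_cat_nat _ _ _ k.+1) //=; last by lia.
rewrite [X in _ = _ + X]big_nat_cond [X in _ = _ + X]big1 ?addn0.
  suff -> : \sum_(1 <= i < k.+1) (2 * k) %/ p ^ i =
      \sum_(1 <= i < k.+1) k %/ p ^ i + \sum_(1 <= i < k.+1) k %/ p ^ i by lia.
  rewrite -big_split /=; apply: eq_bigr => i _.
  have -> : 2 * k = 2 * (k %/ p ^ i) * p ^ i + 2 * (k %% p ^ i).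
    by rewrite {1}(divn_eq k (p ^ i)); ring.
  by rewrite divnMDl ?expn_gt0 ?prime_gt0 // (divn_small (half_mod i)); lia.
move=> i /andP[/andP[k_lt _] _]; rewrite divn_small //.
have := half_mod i; rewrite modn_small //.
exact: ltn_trans k_lt (ltn_expl i (prime_gt1 p_pr)).
Qed.

Import Order.TTheory GRing.Theory Num.Theory.
Local Open Scope ring_scope.

Lemma prime_dvdzM (p : nat) (x y : int) : prime p ->
  (p %| x * y)%Z = (p %| x)%Z || (p %| y)%Z.
Proof. by move=> p_pr; rewrite !dvdzE abszM Euclid_dvdM. Qed.

Lemma sqr_form_unique (p n : nat) (a c d : int) :
  prime p -> (2 < p)%N -> (p != 3)%N -> (0 < n)%N ->
  (p ^ n)%N%:Z = 1 + 3 * a ^+ 2 -> c ^+ 2 + 3 * d ^+ 2 = 1 + 3 * a ^+ 2 ->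
  ~~ ((p %| c)%Z && (p %| d)%Z) -> c ^+ 2 = 1.
Proof.
move=> p_pr p_gt2 p_neq3 n_gt0 qE cdE not_dvd; set q : int := (p ^ n)%N in qE.
have q_gt0 : 0 < q by rewrite /q ltz_nat expn_gt0 prime_gt0.
have p_dvd_q : (p %| q)%Z.
  by rewrite dvdzE /= -[X in (X %| _)%N]expn1 dvdn_exp2l.
have coprime_p m : (0 < m < p)%N -> (p %| Posz m)%Z = false.
  by move=> /andP[m_gt0 m_lt]; rewrite dvdzE /= gtnNdvd.
have p_ndvd3 : (p %| 3)%Z = false.
  by rewrite dvdzE /= dvdn_prime2 // (negPf p_neq3).
have p_ndvd_a : (p %| a)%Z = false.
  apply/negP => p_a; have : (p %| (1 : int))%Z; last first.
    by rewrite (coprime_p 1%N) // (ltn_trans _ p_gt2).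
  have -> : 1 = q - (3 * a) * a by rewrite qE; ring.
  by rewrite rpredB // dvdz_mull.
have p_ndvd_c : (p %| c)%Z = false.
  apply/negP => p_c; move: not_dvd; rewrite p_c /=.
  have : (p %| 3 * d * d)%Z.
    have -> : 3 * d * d = q - c * c by rewrite qE -cdE; ring.
    by rewrite rpredB // dvdz_mull.
  by rewrite !prime_dvdzM // p_ndvd3 /= orbb => ->.
have case_dvd (e : int) : e ^+ 2 = d ^+ 2 -> (q %| c * a - e)%Z -> c ^+ 2 = 1.
  move=> eE /dvdzP[k kE].
  (* Brahmagupta's identity *)
  have norm : (c + 3 * a * e) ^+ 2 + 3 * (c * a - e) ^+ 2 = q ^+ 2.
    have -> : q ^+ 2 = (c ^+ 2 + 3 * e ^+ 2) * (1 + 3 * a ^+ 2).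
      by rewrite eE cdE -qE.
    by ring.
  (* The identity bounds [3 k^2] by 1. Then [e = c a], and [c^2 + 3 e^2 = q] becomes [c^2 q = q]. *)
  have k0 : k = 0.
    have le_k : 3 * k ^+ 2 * q ^+ 2 <= 1 * q ^+ 2.
      rewrite kE in norm; rewrite mul1r -subr_ge0.
      have -> : q ^+ 2 - 3 * k ^+ 2 * q ^+ 2 = (c + 3 * a * e) ^+ 2.
        by rewrite -[X in X - _]norm; ring.
      exact: sqr_ge0.
    rewrite ler_pM2r in le_k; last by rewrite exprn_gt0.
    by move: le_k; clear; nia.
  have ce : e = c * a by apply/esym/eqP; rewrite -subr_eq0 kE k0 mul0r.
  have : c ^+ 2 * q = 1 * q by rewrite {2}qE -cdE -eE ce qE; ring.
  by apply: mulIf; rewrite gt_eqF.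
(* The prime [p] cannot divide both factors, as it does not divide [2 c a]; so its power [q] divides
   one of them, and [case_dvd] applies with [e = d] or [e = - d]. *)
have prod_dvd : (q %| (c * a - d) * (c * a - - d))%Z.
  have -> : (c * a - d) * (c * a - - d) = (a ^+ 2 - d ^+ 2) * q.
    have c2 : c ^+ 2 = 1 + 3 * a ^+ 2 - 3 * d ^+ 2 by rewrite -cdE; ring.
    transitivity (c ^+ 2 * a ^+ 2 - d ^+ 2); first by ring.
    by rewrite c2 qE; ring.
  exact: dvdz_mull.
have [p_d|p_nd] := boolP (p %| c * a - d)%Z; last first.
  apply: (case_dvd (- d)); first exact: sqrrN.
  rewrite Gauss_dvdzr // in prod_dvd.
  by rewrite coprimezE /= coprime_pexpl // prime_coprime // -dvdzE.
apply: (case_dvd d) => //; rewrite Gauss_dvdzl // in prod_dvd.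
rewrite coprimezE /= coprime_pexpl // prime_coprime // -[p]/(absz p) -dvdzE.
apply/negP => p_d'; have : (p %| 2 * c * a)%Z.
  have -> : 2 * c * a = (c * a - d) + (c * a - - d) by ring.
  by rewrite rpredD.
by rewrite !prime_dvdzM // coprime_p // p_ndvd_a p_ndvd_c.
Qed.

(** * The norm of a Jacobi sum *)

Lemma jacobi_sum_norm (F : finFieldType) (K : fieldType) (chi : F -> K) :
  chi 0 = 0 -> chi 1 = 1 -> {morph chi : x y / x * y} ->
  \sum_x chi x = 0 -> \sum_x chi x ^+ 2 = 0 ->
  (\sum_x chi (x * (1 - x))) * (\sum_x (chi (x * (1 - x)))^-1) = #|F|%:R.
Proof.
move=> chi0 chi1 chiM sum1 sum2.
have chi_neq0 x : x != 0 -> chi x != 0.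
  move=> x0; apply/eqP => cx; have := oner_neq0 K.
  by rewrite -chi1 -(mulfV x0) chiM cx mul0r eqxx.
have chiV x : chi x^-1 = (chi x)^-1.
  have [->|x0] := eqVneq x 0; first by rewrite invr0 chi0 invr0.
  by apply: (mulfI (chi_neq0 _ x0)); rewrite -chiM !mulfV ?chi1 ?chi_neq0.
have one0 : (1 : F) != 0 := oner_neq0 F.
have cardF : #|F|%:R = \sum_(x : F) (1 : K) by rewrite sumr_const.
rewrite mulr_suml; under eq_bigr do rewrite mulr_sumr.
rewrite exchange_big /=.
(* Substituting [x = s y] in the double sum separates [chi s] from the value of [chi] at a Moebius
   function of [y]. *)
have inner (y : F) : y != 0 -> y != 1 ->
    \sum_x chi (x * (1 - x)) * (chi (y * (1 - y)))^-1 =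
    \sum_s chi s * chi ((1 - s * y) / (1 - y)).
  move=> y0 y1; rewrite (reindex_inj (mulIf y0)); apply: eq_bigr => s _.
  rewrite -chiV -!chiM; congr chi.
  have ? : 1 - y != 0 by rewrite subr_eq0 eq_sym.
  by field; apply/andP.
(* The terms with [y = 0] and [y = 1] vanish, since the inverse of 0 is 0. *)
rewrite (bigD1 0) //= big1 ?add0r; last first.
  by move=> x _; rewrite mul0r chi0 invr0 mulr0.
rewrite (bigD1 1) //= big1 ?add0r; last first.
  by move=> x _; rewrite subrr mulr0 chi0 invr0 mulr0.
rewrite (eq_bigr _ (fun y yP => inner y (andP yP).1 (andP yP).2)) exchange_big /=.
under eq_bigr do rewrite -mulr_sumr.
have at1 : \sum_(y | (y != 0) && (y != 1)) chi ((1 - 1 * y) / (1 - y)) =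
    #|F|%:R - 2%:R :> K.
  rewrite (eq_bigr (fun=> 1)); last first.
    by move=> y /andP[_ y1]; rewrite mul1r mulfV ?chi1 // subr_eq0 eq_sym.
  by rewrite cardF [in RHS](bigD1 (0 : F)) //=
    [in RHS](bigD1 (1 : F)) //=; ring.
have off1 s : s != 1 ->
    \sum_(y | (y != 0) && (y != 1)) chi ((1 - s * y) / (1 - y)) = - chi s - 1.
  move=> s1; have s1' : 1 - s != 0 by rewrite subr_eq0 eq_sym.
  have full : \sum_(y | y != 1) chi ((1 - s * y) / (1 - y)) = - chi s.
    (* This map permutes [F] and sends 0 to 1, because division by 0 gives 0. At its value [y] the
       quotient [(1 - s y) / (1 - y)] is [s + w], and the sum of [chi (s + w)] over nonzero [w] is
       [- chi s]. *)
    have h_inj : injective (fun w : F => 1 - (1 - s) / w).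
      by move=> u v /addrI /oppr_inj /(mulfI s1') /invr_inj.
    rewrite (reindex_inj h_inj) /= (eq_bigl (fun w => w != 0)); last first.
      move=> w; rewrite -subr_eq0 addrAC subrr add0r oppr_eq0.
      by rewrite mulf_eq0 invr_eq0 (negPf s1').
    have := sum1; rewrite (reindex_inj (@addrI _ s)) (bigD1 0) //= addr0 => /eqP.
    rewrite addr_eq0 => /eqP ->; rewrite opprK; apply: eq_bigr => w w0; congr chi.
    by rewrite subKr; field; apply/andP.
  have := full; rewrite (bigD1 0) 1?eq_sym //= mulr0 !subr0 divr1 chi1.
  rewrite (eq_bigl (fun y => (y != 0) && (y != 1))); last by move=> y; rewrite andbC.
  by move=> <-; ring.
(* What remains is [q - 2] minus the sum of [chi s ^ 2 + chi s] over [s] different from 1; each of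
   these two sums is -1. *)
rewrite (bigD1 1) //= at1 chi1 mul1r.
rewrite (eq_bigr (fun s => - chi s ^+ 2 - chi s)); last first.
  by move=> s s1; rewrite off1 //; ring.
have e1 := sum1; have e2 := sum2.
rewrite (bigD1 1) //= chi1 in e1; rewrite (bigD1 1) //= chi1 in e2.
rewrite big_split /= !sumrN.
by rewrite -[X in - X - _](addKr (1 ^+ 2)) e2 -[X in _ - X](addKr 1) e1; ring.
Qed.

(** * Classes and cyclotomic numbers of order 6 *)

Section SexticClasses.

Variables (F : finFieldType) (gamma : F) (l : nat).
Hypothesis gamma_prim : (#|F|.-1).-primitive_root gamma.
Hypothesis cardF : #|F|.-1 = (6 * l)%N.

(* [dlog 0 = 0] *)
Definition dlog (x : F) : nat :=
  if [pick i : 'I_#|F|.-1 | x == gamma ^+ i] is Some i then i else 0%N.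
Arguments dlog x%_R.

Lemma gamma_neq0 : gamma != 0.
Proof.
apply/eqP => g0; have := prim_expr_order gamma_prim.
rewrite g0 expr0n gtn_eqF ?(prim_order_gt0 gamma_prim) // => /eqP.
by rewrite eq_sym oner_eq0.
Qed.

Lemma dlogK x : x != 0 -> gamma ^+ dlog x = x.
Proof.
move=> x0; have : x ^+ #|F|.-1 = 1.
  apply: (mulfI x0); rewrite -exprS prednK ?expf_card ?mulr1 //.
  exact: ltnW (finNzRing_gt1 F).
case/(prim_rootP gamma_prim) => i xE.
by rewrite /dlog; case: pickP => [j /eqP->//|/(_ i)]; rewrite xE eqxx.
Qed.

Lemma dlog_exp m : (dlog (gamma ^+ m) = m %[mod 6])%N.
Proof.
have /eqP := dlogK (expf_neq0 m gamma_neq0).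
rewrite (eq_prim_root_expr gamma_prim) cardF => /eqP /(congr1 (modn^~ 6)).
by rewrite !modn_dvdm // dvdn_mulr.
Qed.

Lemma dlogM x y : x != 0 -> y != 0 ->
  (dlog (x * y) = dlog x + dlog y %[mod 6])%N.
Proof. by move=> /dlogK {1}<- /dlogK {1}<-; rewrite -exprD dlog_exp. Qed.

Lemma dlog1 : (dlog 1 = 0 %[mod 6])%N.
Proof. by rewrite -(expr0 gamma) dlog_exp. Qed.

Lemma dlogV x : x != 0 -> (dlog x^-1 + dlog x = 0 %[mod 6])%N.
Proof. by move=> x0; rewrite -dlogM ?invr_eq0 // mulVf // dlog1. Qed.

Definition cls (k : nat) (x : F) := (x != 0) && (dlog x == k %[mod 6])%N.
Arguments cls k%_N x%_R.

Lemma cls_mod j k x : (j = k %[mod 6])%N -> cls j x = cls k x.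
Proof. by rewrite /cls => ->. Qed.

Lemma clsM a i j k x : cls i a -> (j + i = k %[mod 6])%N ->
  cls k (x * a) = cls j x.
Proof.
rewrite /cls mulf_eq0 negb_or => /andP[a0 /eqP ai] ek; rewrite a0 andbT.
by have [//|x0 /=] := eqVneq x 0; have := dlogM x0 a0; lia.
Qed.

Lemma clsV i j x : (i + j = 0 %[mod 6])%N -> cls j x^-1 = cls i x.
Proof.
move=> ij; rewrite /cls invr_eq0; have [//|x0 /=] := eqVneq x 0.
by have := dlogV x0; lia.
Qed.

Lemma cls_exp k m : cls k (gamma ^+ m) = (m == k %[mod 6])%N.
Proof. by rewrite /cls expf_neq0 ?gamma_neq0 //= dlog_exp. Qed.

Lemma cls1 k : cls k 1 = (k %% 6 == 0)%N.
Proof. by rewrite -(expr0 gamma) cls_exp eq_sym mod0n. Qed.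

Lemma sum_cls x : (\sum_(k < 6) cls k x)%N = (x != 0%R).
Proof.
rewrite /cls; have [x0|x0] /= := eqVneq x 0; first by rewrite big1.
have := ltn_pmod (dlog x) (isT : 0 < 6)%N.
by rewrite !big_ord_recr big_ord0 /=; case: (_ %% _)%N => [|[|[|[|[|[|]]]]]].
Qed.

Lemma card_cls k : (\sum_x cls k x)%N = l.
Proof.
have shift m : (\sum_x cls m x)%N = (\sum_x cls 0 x)%N.
  rewrite (reindex_inj (mulIf (expf_neq0 m gamma_neq0))).
  by apply: eq_bigr => x _; rewrite (@clsM _ m 0) ?add0n // cls_exp eqxx.
have : (6 * \sum_x cls 0 x = 6 * l)%N.
  transitivity (\sum_(k < 6) \sum_x cls k x)%N.
    by rewrite (eq_bigr _ (fun (i : 'I_6) _ => shift i)) sum_nat_const card_ord.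
  rewrite exchange_big /= -cardF; under eq_bigr do rewrite sum_cls.
  rewrite -sum1_card [in RHS](bigD1 0) //= [in RHS]big_mkcond /=.
  by apply: eq_bigr => x _; case: eqP.
by rewrite shift; lia.
Qed.

(* The usual cyclotomic number counts [x] in [D_i] with [1 + x] in [D_j]; the two
   conventions agree when [-1] is in [D_0]. *)
Definition cyc (i j : nat) := (\sum_x (cls i x && cls j (1 - x)))%N.

Lemma cyc_mod i i' j j' : (i = i' %[mod 6])%N -> (j = j' %[mod 6])%N ->
  cyc i j = cyc i' j'.
Proof.
move=> ei ej; apply: eq_bigr => x _.
by rewrite (cls_mod _ ei) (cls_mod _ ej).
Qed.

Lemma cycC i j : cyc i j = cyc j i.
Proof.
rewrite /cyc (reindex_inj (inv_inj (subKr 1))) /=.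
by apply: eq_bigr => x _; rewrite subKr andbC.
Qed.

(** Summing over the class of [x] loses only [x = 0], where [1 - x = 1] lies in D_0; this accounts
    for the extra term. *)
Lemma sum_cyc k : (\sum_(j < 6) cyc j k + (k %% 6 == 0))%N = l.
Proof.
rewrite exchange_big /= -[RHS](card_cls k).
rewrite [in RHS](reindex_inj (inv_inj (subKr 1))) /= [in RHS](bigD1 0) //=.
rewrite subr0 cls1 addnC; congr (_ + _)%N.
rewrite [in RHS]big_mkcond /=; apply: eq_bigr => x _.
under eq_bigr do rewrite -mulnb.
by rewrite -big_distrl /= sum_cls; case: eqP => //; rewrite mul1n.
Qed.

(** These counts are the coefficients of the Jacobi sum of [chi (x (1 - x))] for a character [chi]
    trivial on D_0. *)
Definition cls_quad k := (\sum_x cls k (x * (1 - x)))%N.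

Lemma cls_quadE k : cls_quad k = (\sum_(i < 6) cyc i ((k + 6 - i) %% 6))%N.
Proof.
rewrite exchange_big /=; apply: eq_bigr => x _.
have [x0|x0] := eqVneq x 0.
  by rewrite big1 /cls ?x0 ?mul0r ?eqxx // => i _; rewrite eqxx.
rewrite (eq_bigr (fun i : 'I_6 => (cls i x * cls k (x * (1 - x)))%N)).
  by rewrite -big_distrl /= sum_cls x0 mul1n.
move=> i _; case xi: (cls i x) => //=.
rewrite mul1n mulrC (clsM _ xi (_ : (k + 6 - i) %% 6 + i = k %[mod 6])%N) //.
by have := ltn_ord i; lia.
Qed.

(** * Arcs and degrees of the Cayley digraph *)

Lemma ellE : ell F = l.
Proof. by rewrite /ell cardF mulKn. Qed.

Lemma dlog_ltn x : (dlog x < 6 * l)%N.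
Proof.
rewrite -cardF /dlog; case: pickP => [i _ //|_].
exact: prim_order_gt0 gamma_prim.
Qed.

Lemma sum_cls0 (P : F -> bool) :
  (\sum_c (cls 0 c && P c) = \sum_(j < l) P (gamma ^+ (6 * j)))%N.
Proof.
have count c : (\sum_(j < l) (c == gamma ^+ (6 * j)) = cls 0 c)%N.
  have [c0|nc0] := boolP (cls 0 c); last first.
    rewrite big1 // => j _; apply/eqP; rewrite eqb0; apply: contraNneq nc0 => ->.
    by rewrite cls_exp; lia.
  have lt_m : (dlog c %/ 6 < l)%N by have := dlog_ltn c; lia.
  have cE : c = gamma ^+ (6 * (dlog c %/ 6)).
    case/andP: c0 => c_neq0 dc; rewrite -{1}(dlogK c_neq0); congr (_ ^+ _).
    by lia.
  rewrite (bigD1 (Ordinal lt_m)) //= -cE eqxx big1 // => j j_neq.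
  apply/eqP; rewrite eqb0 {1}cE (eq_prim_root_expr gamma_prim) cardF.
  apply: contra j_neq => /eqP; rewrite !modn_small ?ltn_pmul2l // => e.
  by apply/eqP/val_inj => /=; lia.
transitivity (\sum_c \sum_(j < l) ((c == gamma ^+ (6 * j)) * P c))%N.
  by apply: eq_bigr => c _; rewrite -big_distrl /= count mulnb.
rewrite exchange_big /=; apply: eq_bigr => j _.
rewrite (bigD1 (gamma ^+ (6 * j))) //= eqxx mul1n big1 ?addn0 // => c.
by move/negPf->.
Qed.

Lemma mem_cyc_class3 x : (x \in cyc_class gamma 6 3) = cls 3 x.
Proof.
apply/imsetP/idP => [[m _ ->]|].
  by rewrite -exprM -exprD cls_exp; lia.
case/andP=> x0 /eqP dx; have lt_m : (dlog x %/ 6 < #|F|)%N.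
  by have := dlog_ltn x; have := finNzRing_gt1 F; lia.
exists (Ordinal lt_m) => //=; rewrite -exprM -exprD -{1}(dlogK x0).
by congr (_ ^+ _); lia.
Qed.

(** For [g = (x, i)], [h = (y, j)] and [c = gamma^(6 i)], the product of the inverse of [g] with [h]
    has first coordinate [(y - x) / c], which is in S when [(y - x) / c + 1] is in D_3.
    Multiplication by [c], an element of D_0, clears the denominator. *)
Lemma cay_arcE (g h : F * 'I_(ell F)) :
  cay_arc gamma g h = cls 3 (h.1 - g.1 + gamma ^+ (6 * g.2)).
Proof.
case: g h => [x i] [y j]; rewrite /cay_arc inE /=.
set c := gamma ^+ (6 * i); have c0 : c != 0 by rewrite expf_neq0 ?gamma_neq0.
have -> : gamma ^+ (6 * ((ell F - i) %% ell F)) = c^-1.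
  apply: (mulIf c0); rewrite mulVf // -exprD -mulnDr; apply/eqP.
  rewrite -(prim_order_dvd gamma_prim) cardF -ellE dvdn_pmul2l // /dvdn.
  by rewrite modnDml subnK ?modnn // ltnW.
have S_mem u : (u \in Sset gamma) = cls 3 (u + 1).
  rewrite -mem_cyc_class3; apply/imsetP/idP => [[v v_in ->]|u_in].
    by rewrite addrAC addNr add0r.
  by exists (u + 1) => //; rewrite addrC addrK.
have c_cls : cls 0 c by rewrite cls_exp; lia.
rewrite S_mem -(clsM _ c_cls (_ : 3 + 0 = 3 %[mod 6])%N) //; congr cls.
by field.
Qed.

Lemma cay_out_degree g : (\sum_h cay_arc gamma g h = l * l)%N.
Proof.
under eq_bigr do rewrite cay_arcE.
rewrite -(pair_bigA _ (fun (y : F) (j : 'I_(ell F)) =>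
  nat_of_bool (cls 3 (y - g.1 + gamma ^+ (6 * g.2))))) /=.
under eq_bigr do rewrite sum_nat_const card_ord.
rewrite -big_distrr /=; congr (_ * _)%N; first exact: ellE.
rewrite -[RHS](card_cls 3).
rewrite [RHS](reindex_inj (addIr (- g.1 + gamma ^+ (6 * g.2)))) /=.
by apply: eq_bigr => y _; rewrite addrA.
Qed.

Lemma cay_in_degree h : (\sum_g cay_arc gamma g h = l * l)%N.
Proof.
under eq_bigr do rewrite cay_arcE.
rewrite -(pair_bigA _ (fun (x : F) (i : 'I_(ell F)) =>
  nat_of_bool (cls 3 (h.1 - x + gamma ^+ (6 * i))))) /= exchange_big /=.
rewrite -[X in (X * _)%N]ellE -[X in (X * _)%N]card_ord -sum_nat_const.
apply: eq_bigr => i _; rewrite -[RHS](card_cls 3).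
rewrite [RHS](reindex_inj (inv_inj (subKr (h.1 + gamma ^+ (6 * i))))) /=.
by apply: eq_bigr => x _; rewrite addrAC.
Qed.

(** * Linear relations between the cyclotomic numbers *)

Hypothesis l_even : ~~ odd l.

Lemma clsN1 : cls 0 (-1).
Proof.
have l_gt0 : (0 < l)%N by have := prim_order_gt0 gamma_prim; lia.
have -> : -1 = gamma ^+ (3 * l); last by rewrite cls_exp; lia.
have /eqP : (gamma ^+ (3 * l)) ^+ 2 = 1.
  rewrite -exprM (_ : 3 * l * 2 = 6 * l)%N; last by lia.
  by rewrite -cardF (prim_expr_order gamma_prim).
rewrite sqrf_eq1 => /orP[|/eqP->//]; rewrite -(prim_order_dvd gamma_prim) cardF.
by move/dvdn_leq; lia.
Qed.

Lemma clsN k x : cls k (- x) = cls k x.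
Proof. by rewrite -mulrN1 (clsM _ clsN1 (_ : k + 0 = k %[mod 6])%N) // addn0. Qed.

(** This is the substitution [x -> 1 / x], with [1 - 1 / x = - (1 - x) / x] and -1 in D_0. *)
Lemma cycV i j i' j' : (i + i' = 0 %[mod 6])%N -> (j' + i = j %[mod 6])%N ->
  cyc i j = cyc i' j'.
Proof.
move=> ei ej; rewrite /cyc (reindex_inj invr_inj) /=; apply: eq_bigr => x _.
rewrite (@clsV i') 1?addnC //; case xi: (cls i' x) => //=.
have x0 : x != 0 by case/andP: xi.
have -> : 1 - x^-1 = - (1 - x) * x^-1 by field.
have xVi : cls i x^-1 by rewrite (@clsV i') 1?addnC.
by rewrite (clsM _ xVi ej) clsN.
Qed.

Hypothesis two_cube : exists z : F, z != 0 /\ 2%:R = z ^+ 3.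

Lemma two_neq0 : 2%:R != 0 :> F.
Proof. by case: two_cube => z [z0 ->]; rewrite expf_neq0. Qed.

Lemma cls4 : cls 0 4%:R.
Proof.
case: two_cube => z [z0 zE]; rewrite (natrM _ 2 2) zE -exprD.
by rewrite -(dlogK z0) -exprM cls_exp; lia.
Qed.

Lemma card_sqrt (u : F) : u != 0 ->
  #|[pred y : F | y ^+ 2 == u]| = (2 * (\sum_(j < 3) cls (2 * j) u))%N.
Proof.
move=> u0.
have [/existsP[s /eqP sE]|no_sqrt] := boolP [exists s : F, s ^+ 2 == u].
  have s0 : s != 0 by apply: contraNneq u0 => s0; rewrite -sE s0 expr0n.
  rewrite (eq_card (_ : _ =i pred2 s (- s))); last first.
    by move=> y; rewrite !inE -sE eqf_sqr.
  rewrite card2 (_ : s != - s); last first.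
    by rewrite -subr_eq0 opprK -mulr2n -mulr_natl mulf_neq0 ?two_neq0.
  rewrite -sE -(dlogK s0) -exprM !big_ord_recr big_ord0 /= !cls_exp.
  by have := ltn_pmod (dlog s * 2) (isT : 0 < 6)%N; lia.
rewrite eq_card0; last first.
  by move=> y; apply/negP; rewrite inE => yE; case/existsP: no_sqrt; exists y.
rewrite big1 // => j _; apply/eqP; rewrite eqb0; apply/negP => /andP[_ uj].
case/existsP: no_sqrt; exists (gamma ^+ (dlog u)./2).
by rewrite -exprM (_ : (dlog u)./2 * 2 = dlog u)%N ?dlogK //; lia.
Qed.

(** With [y = 2 x - 1] one has [4 x (1 - x) = 1 - y^2], where 4 lies in D_0. Grouping by [u = y^2],
    the value [y = 0] gives the first term, and each [u] in D_0, D_2 or D_4 has two square roots. *)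
Lemma cls_quad_dup k :
  cls_quad k = ((k %% 6 == 0) + 2 * (cyc 0 k + cyc 2 k + cyc 4 k))%N.
Proof.
have half_inj : injective (fun y : F => (1 + y) / 2%:R).
  by move=> y z /(mulIf (invr_neq0 two_neq0)) /addrI.
rewrite /cls_quad (reindex_inj half_inj) /=.
have quad y : cls k ((1 + y) / 2%:R * (1 - (1 + y) / 2%:R)) = cls k (1 - y ^+ 2).
  have -> : 1 - y ^+ 2 = (1 + y) / 2%:R * (1 - (1 + y) / 2%:R) * 4%:R.
    by field; exact: two_neq0.
  by rewrite (clsM _ cls4 (_ : k + 0 = k %[mod 6])%N) // addn0.
rewrite (eq_bigr _ (fun y _ => congr1 nat_of_bool (quad y))) (bigD1 0) //=.
rewrite expr0n subr0 cls1; congr (_ + _)%N.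
rewrite (partition_big (fun y : F => y ^+ 2) (fun u => u != 0)) /=; last first.
  by move=> y; exact: expf_neq0.
transitivity
  (\sum_(u | u != 0%R) (2 * (\sum_(j < 3) (cls (2 * j) u && cls k (1 - u)))))%N.
  apply: eq_bigr => u u0.
  rewrite (eq_bigr (fun=> nat_of_bool (cls k (1 - u)))); last first.
    by move=> y /andP[_ /eqP->].
  rewrite sum_nat_const (eq_card (_ : _ =i [pred y : F | y ^+ 2 == u])).
    rewrite card_sqrt // -mulnA big_distrl /=; congr (_ * _)%N.
    by apply: eq_bigr => j _; rewrite mulnb.
  move=> y; rewrite !inE; apply: andb_idl => /eqP yE.
  by apply: contraNneq u0 => y0; rewrite -yE y0 expr0n.
rewrite -big_distrr /= exchange_big /= !big_ord_recr big_ord0 /= add0n.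
have drop0 j : (\sum_(u | u != 0%R) (cls j u && cls k (1 - u)))%N = cyc j k.
  by rewrite /cyc [in RHS](bigD1 0) //= [cls j 0]/cls eqxx.
by rewrite !drop0.
Qed.

(* Up to the symmetries [cycC] and [cycV] there are ten cyclotomic numbers of
   order 6; the proof rewrites everything in terms of them. *)
Lemma sextic_relations :
  [/\ cyc 3 1 = cyc 3 2, (2 * cyc 3 0 + 4 * cyc 3 1 = l)%N,
      forall i, cyc 3 i = cyc 3 (i %% 3) &
      (cls_quad 0 + cls_quad 3 + 6 * cyc 3 0 + 1 = 3 * l)%N] /\
  [/\ (6 %| cls_quad 1 + cls_quad 4)%N, (6 %| cls_quad 2 + cls_quad 5)%N &
      (\sum_(k < 6) cls_quad k + 1 = 6 * l)%N].
Proof.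
have Q0 : cls_quad 0 =
    (cyc 0 0 + cyc 1 5 + cyc 2 4 + cyc 3 3 + cyc 4 2 + cyc 5 1)%N.
  by rewrite cls_quadE !big_ord_recr big_ord0.
have Q1 : cls_quad 1 =
    (cyc 0 1 + cyc 1 0 + cyc 2 5 + cyc 3 4 + cyc 4 3 + cyc 5 2)%N.
  by rewrite cls_quadE !big_ord_recr big_ord0.
have Q2 : cls_quad 2 =
    (cyc 0 2 + cyc 1 1 + cyc 2 0 + cyc 3 5 + cyc 4 4 + cyc 5 3)%N.
  by rewrite cls_quadE !big_ord_recr big_ord0.
have Q3 : cls_quad 3 =
    (cyc 0 3 + cyc 1 2 + cyc 2 1 + cyc 3 0 + cyc 4 5 + cyc 5 4)%N.
  by rewrite cls_quadE !big_ord_recr big_ord0.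
have Q4 : cls_quad 4 =
    (cyc 0 4 + cyc 1 3 + cyc 2 2 + cyc 3 1 + cyc 4 0 + cyc 5 5)%N.
  by rewrite cls_quadE !big_ord_recr big_ord0.
have Q5 : cls_quad 5 =
    (cyc 0 5 + cyc 1 4 + cyc 2 3 + cyc 3 2 + cyc 4 1 + cyc 5 0)%N.
  by rewrite cls_quadE !big_ord_recr big_ord0.
have S' k : (cyc 0 k + cyc 1 k + cyc 2 k + cyc 3 k + cyc 4 k + cyc 5 k
    + (k %% 6 == 0) = l)%N.
  by rewrite -[RHS](sum_cyc k) !big_ord_recr big_ord0.
have [e01 e02 e03] : [/\ cyc 1 0 = cyc 0 1, cyc 5 5 = cyc 0 1 & cyc 1 1 = cyc 0 5].
  by split; [exact: cycC
    |rewrite [RHS]cycC; apply: cycV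
    |rewrite [RHS]cycC; apply: cycV].
have [e04 e05 e06] : [/\ cyc 5 0 = cyc 0 5, cyc 2 0 = cyc 0 2 & cyc 4 4 = cyc 0 2].
  by split; [exact: cycC|exact: cycC|rewrite [RHS]cycC; apply: cycV].
have [e07 e08 e09] : [/\ cyc 4 0 = cyc 0 4, cyc 2 2 = cyc 0 4 & cyc 3 3 = cyc 3 0].
  by split; [exact: cycC|rewrite [RHS]cycC; apply: cycV|apply: cycV].
have e10 : cyc 0 3 = cyc 3 0 by exact: cycC.
have [e11 e12 e13] : [/\ cyc 2 1 = cyc 1 2, cyc 5 1 = cyc 1 2 & cyc 1 5 = cyc 1 2].
  by split; [exact: cycC|apply: cycV|rewrite cycC; apply: cycV].
have [e14 e15] : cyc 4 5 = cyc 1 2 /\ cyc 5 4 = cyc 1 2.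
  by split; [|rewrite cycC]; rewrite [RHS]cycC; apply: cycV.
have [e16 e17 e18] : [/\ cyc 1 3 = cyc 3 1, cyc 5 2 = cyc 3 1 & cyc 2 5 = cyc 3 1].
  by split; [exact: cycC
    |rewrite [RHS]cycC; apply: cycV
    |rewrite cycC [RHS]cycC; apply: cycV].
have [e19 e20] : cyc 3 4 = cyc 3 1 /\ cyc 4 3 = cyc 3 1.
  by split; [|rewrite cycC]; apply: cycV.
have [e21 e22 e23] : [/\ cyc 2 3 = cyc 3 2, cyc 4 1 = cyc 3 2 & cyc 1 4 = cyc 3 2].
  by split; [exact: cycC
    |rewrite [RHS]cycC; apply: cycV
    |rewrite cycC [RHS]cycC; apply: cycV].
have [e24 e25 e26] : [/\ cyc 3 5 = cyc 3 2, cyc 5 3 = cyc 3 2 & cyc 4 2 = cyc 2 4].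
  by split; [apply: cycV|rewrite cycC; apply: cycV|exact: cycC].
have D k := cls_quad_dup k; have := (D 0, D 1, D 2, D 3, D 4, D 5)%N.
have := (S' 0, S' 1, S' 2, S' 3)%N.
rewrite !(e01, e02, e03, e04, e05, e06, e07, e08, e09, e10, e11, e12, e13, e14,
  e15, e16, e17, e18, e19, e20, e21, e22, e23, e24, e25, e26) in
  Q0 Q1 Q2 Q3 Q4 Q5 *.
move=> [[[]]] S0 S1 S2 S3 [[[[[]]]]] D0 D1 D2 D3 D4 D5.
have per i : cyc 3 i = cyc 3 (i %% 3).
  rewrite (@cyc_mod 3 3 i (i %% 6)) ?modn_mod // -(@modn_dvdm 6 i 3) //.
  have := ltn_pmod i (isT : 0 < 6)%N.
  by case: (i %% 6)%N => [|[|[|[|[|[|]]]]]] // _; rewrite -?e09 -?e19 -?e24.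
rewrite /= in S0 S1 S2 S3 D0 D1 D2 D3 D4 D5.
(* Writing (i, j) for [cyc i j], the two evaluations of [cls_quad 1] give 2 (3, 1) = (1, 2) + (3,
   2), and those of [cls_quad 5] give 2 (3, 2) = (3, 1) + (1, 2); so these three numbers agree. *)
have E1 : cyc 3 1 = cyc 3 2 by clear -Q1 Q5 D1 D5 S1; lia.
have E2 : (cyc 3 1 = cyc 1 2)%N by clear -Q1 Q5 D1 D5 S1 E1; lia.
have E3 : (2 * cyc 3 0 + 4 * cyc 3 1 = l)%N by clear -S3 E1; lia.
split; split=> //.
- by clear -Q0 Q3 D0 D3 S0 S1 S3 E1 E2 E3; lia.
- by clear -Q1 Q4 D1 D4; lia.
- by clear -Q2 Q5 D2 D5; lia.
- rewrite !big_ord_recr big_ord0 /=.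
  by clear -D0 D1 D2 D3 D4 D5 S0 S1 S2 S3 Q0 Q1 Q2 Q3 Q4 Q5 E1 E2 E3; lia.
Qed.

(** * The cubic Jacobi sum and its norm *)

Definition cubic_char (R : nzRingType) (w : R) (x : F) : R :=
  if x == 0 then 0 else w ^+ dlog x.

Lemma cubic_char_cls (R : nzRingType) (w : R) x : w ^+ 3 = 1 ->
  cubic_char w x = \sum_(k < 6) (cls k x)%:R * w ^+ k.
Proof.
move=> w3; have w6 : w ^+ 6 = 1 by rewrite (exprM w 3 2) w3 expr1n.
rewrite /cubic_char /cls; case: eqVneq => [_|x0] /=.
  by rewrite big1 // => k _; rewrite mul0r.
rewrite -(expr_mod _ w6) !big_ord_recr big_ord0 /=.
have := ltn_pmod (dlog x) (isT : 0 < 6)%N.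
by case: (_ %% 6)%N => [|[|[|[|[|[|]]]]]] //= _; rewrite !(mul0r, mul1r, add0r, addr0).
Qed.

Lemma cubic_char_sum (R : comNzRingType) (w : R) : w ^+ 3 = 1 ->
  1 + w + w ^+ 2 = 0 -> \sum_x cubic_char w x = 0.
Proof.
move=> w3 w0; under eq_bigr do rewrite cubic_char_cls //.
rewrite exchange_big /=.
have -> : \sum_(k < 6) \sum_x (cls k x)%:R * w ^+ k = \sum_(k < 6) l%:R * w ^+ k.
  by apply: eq_bigr => k _; rewrite -mulr_suml -natr_sum card_cls.
rewrite -mulr_sumr !big_ord_recr big_ord0 /=.
have -> : 0 + w ^+ 0 + w ^+ 1 + w ^+ 2 + w ^+ 3 + w ^+ 4 + w ^+ 5 =
  (1 + w + w ^+ 2) * (1 + w ^+ 3) by ring.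
by rewrite w0 mul0r mulr0.
Qed.

(** The ring is left general for two uses: [algC], where the norm of J is computed, and [F] with
    [w = gamma^(4 l)], where the formula gives the reduction of J modulo a prime above p. *)
Lemma cubic_char_quad (R : comNzRingType) (w : R) : w ^+ 3 = 1 ->
  \sum_x cubic_char w (x * (1 - x)) = (cls_quad 0 + cls_quad 3)%:R +
    (cls_quad 1 + cls_quad 4)%:R * w + (cls_quad 2 + cls_quad 5)%:R * w ^+ 2.
Proof.
move=> w3; under eq_bigr do rewrite cubic_char_cls //.
rewrite exchange_big /=.
have -> : \sum_(k < 6) \sum_x (cls k (x * (1 - x)))%:R * w ^+ k =
    \sum_(k < 6) (cls_quad k)%:R * w ^+ k.
  by apply: eq_bigr => k _; rewrite -mulr_suml -natr_sum.
rewrite !big_ord_recr big_ord0 /= (exprD w 3 1) (exprD w 3 2) w3 !natrD; ring.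
Qed.

(** The character of [w^2] is the inverse of that of [w], so [jacobi_sum_norm] equates the product
    of [n0 + n1 w + n2 w^2] and its conjugate with q; eliminating [w^2 = - 1 - w] leaves an identity
    between integers. *)
Lemma cubic_jacobi_norm (n0 n1 n2 : nat) :
  n0 = (cls_quad 0 + cls_quad 3)%N -> n1 = (cls_quad 1 + cls_quad 4)%N ->
  n2 = (cls_quad 2 + cls_quad 5)%N ->
  n0%:Z ^+ 2 + n1%:Z ^+ 2 + n2%:Z ^+ 2 =
  n0%:Z * n1%:Z + n1%:Z * n2%:Z + n2%:Z * n0%:Z + #|F|%:Z.
Proof.
move=> n0E n1E n2E.
have [w w_prim] := C_prim_root_exists (isT : 0 < 3)%N.
have w3 : w ^+ 3 = 1 := prim_expr_order w_prim.
have w_neq1 : w != 1 by rewrite -(prim_order_dvd w_prim 1).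
have w_neq0 : w != 0 
  by apply/eqP => w0; move: w3; rewrite w0 expr0n => /eqP; rewrite eq_sym oner_eq0.
have w_sum : 1 + w + w ^+ 2 = 0.
  apply: (mulfI (_ : w - 1 != 0)); first by rewrite subr_eq0.
  have -> : (w - 1) * (1 + w + w ^+ 2) = w ^+ 3 - 1 by ring.
  by rewrite w3 subrr mulr0.
have w2_3 : (w ^+ 2) ^+ 3 = 1 by rewrite exprAC w3 expr1n.
have w2_sum : 1 + w ^+ 2 + (w ^+ 2) ^+ 2 = 0.
  by rewrite -[RHS]w_sum -exprM (exprD w 3 1) w3 mul1r expr1; ring.
have w6 : w ^+ 6 = 1 by rewrite (exprM w 3 2) w3 expr1n.
have sqr_char x : cubic_char w x ^+ 2 = cubic_char (w ^+ 2) x.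
  by rewrite /cubic_char; case: ifP => _; rewrite ?expr0n // exprAC.
have inv_char x : (cubic_char w x)^-1 = cubic_char (w ^+ 2) x.
  rewrite -sqr_char /cubic_char; case: ifP => _; first by rewrite invr0 expr0n.
  apply: (mulfI (expf_neq0 (dlog x) w_neq0)); rewrite mulfV ?expf_neq0 //.
  by rewrite -exprS exprAC w3 expr1n.
have char0 : cubic_char w 0 = 0 by rewrite /cubic_char eqxx.
have char1 : cubic_char w 1 = 1.
  by rewrite /cubic_char oner_eq0 -(expr_mod _ w6) dlog1.
have charM : {morph cubic_char w : x y / x * y}.
  move=> x y; rewrite /cubic_char mulf_eq0.
  have [|x0] := eqVneq x 0; first by rewrite mul0r.
  have [|y0] /= := eqVneq y 0; first by rewrite mulr0.
  by rewrite -(expr_mod _ w6) dlogM // expr_mod // exprD.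
have sum_sqr : \sum_x cubic_char w x ^+ 2 = 0.
  by rewrite (eq_bigr _ (fun x _ => sqr_char x)) cubic_char_sum.
have := jacobi_sum_norm char0 char1 charM (cubic_char_sum w3 w_sum) sum_sqr.
rewrite [X in _ * X](eq_bigr _ (fun x _ => inv_char _)).
rewrite !cubic_char_quad // -n0E -n1E -n2E => e; apply: (@intr_inj algC).
rewrite !(rmorphD, rmorphM, rmorphXn) /= -[#|F|%:~R]e.
have w2E : w ^+ 2 = - 1 - w.
  by apply/eqP; rewrite -subr_eq0 -[X in _ == X]w_sum; apply/eqP; ring.
ring: w2E.
Qed.

(** * Power sums in F and the Jacobi sum modulo p *)

Lemma power_sum_eq0 m : ~~ (#|F|.-1 %| m)%N -> \sum_x (x : F) ^+ m = 0.
Proof.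
rewrite (prim_order_dvd gamma_prim) => gm; set S := \sum_x _.
have : (gamma ^+ m - 1) * S = 0.
  rewrite mulrBl mul1r; apply/eqP; rewrite subr_eq0; apply/eqP.
  rewrite mulr_sumr [RHS](reindex_inj (mulfI gamma_neq0)).
  by apply: eq_bigr => x _; rewrite exprMn.
by move/eqP; rewrite mulf_eq0 subr_eq0 (negPf gm) => /eqP.
Qed.

Lemma card_natr_eq0 p n : p \in [pchar F] -> #|F| = (p ^ n.+1)%N ->
  #|F|%:R = 0 :> F.
Proof. by move=> pF ->; rewrite expnS natrM (pcharf0 pF) mul0r. Qed.

Lemma power_sum_card p n : p \in [pchar F] -> #|F| = (p ^ n.+1)%N ->
  \sum_x (x : F) ^+ #|F|.-1 = -1.
Proof.
move=> pF qE; have q_gt0 : (0 < #|F|.-1)%N := prim_order_gt0 gamma_prim.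
rewrite (bigD1 0) //= expr0n gtn_eqF // add0r.
rewrite (eq_bigr (fun=> 1)); last first.
  move=> x x0; apply: (mulfI x0).
  by rewrite -exprS prednK ?expf_card ?mulr1 // ltnW ?finNzRing_gt1.
have cardE : #|F|%:R = \sum_(x : F) (1 : F) by rewrite sumr_const.
have := card_natr_eq0 pF qE; rewrite cardE (bigD1 0) //= => /eqP.
by rewrite addrC addr_eq0 => /eqP.
Qed.

(** This sum is J reduced modulo a prime above p. In its binomial expansion the exponents run from
    [4 l] to [8 l], so only [x^(6 l) = x^(q - 1)] contributes, with coefficient [C(4 l, 2 l)] up to
    sign; [central_bin_coprime] applies with [k = 2 l]. *)
Lemma quad_power_sum_neq0 p n : p \in [pchar F] -> #|F| = (p ^ n.+1)%N ->
  (p %% 3 = 1)%N -> \sum_x ((x : F) * (1 - x)) ^+ (4 * l) != 0.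
Proof.
move=> pF qE p3; have p_pr := pcharf_prime pF.
have q_gt0 : (0 < #|F|.-1)%N := prim_order_gt0 gamma_prim.
have expand (x : F) : (x * (1 - x)) ^+ (4 * l) =
    \sum_(i < (4 * l).+1) ((-1) ^+ i *+ 'C(4 * l, i)) * x ^+ (4 * l + i).
  rewrite exprMn exprDn mulr_sumr; apply: eq_bigr => i _.
  by rewrite expr1n mul1r (exprNn x) exprD mulrnAr mulrnAl mulrCA.
under eq_bigr do rewrite expand.
rewrite exchange_big /=; under eq_bigr do rewrite -mulr_sumr.
have lt_2l : (2 * l < (4 * l).+1)%N by lia.
rewrite (bigD1 (Ordinal lt_2l)) //= [X in _ + X]big1 ?addr0; last first.
  move=> i /eqP ne. rewrite power_sum_eq0 ?mulr0 // cardF.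
  have i2l : (i <> 2 * l :> nat)%N by move=> e; apply: ne; apply: val_inj.
  apply/negP => /dvdnP[k kE]; have := ltn_ord i.
  by case: k kE => [|[|k]]; nia.
rewrite (_ : 4 * l + 2 * l = #|F|.-1)%N; last by rewrite cardF; lia.
rewrite (power_sum_card pF qE) mulrN1 oppr_eq0 -mulr_natr mulf_neq0 ?signr_eq0 //.
rewrite -(dvdn_pcharf pF) (_ : 4 * l = 2 * (2 * l))%N; last by lia.
by apply: (@central_bin_coprime p n.+1) => //; have := finNzRing_gt1 F; lia.
Qed.

(** * Evaluation of the cyclotomic numbers (3, i) *)

Lemma cyc3_eq (a : int) : #|F|%:Z = 1 + 3 * a ^+ 2 ->
  forall i, (6 * cyc 3 i = l)%N.
Proof.
move=> qa.
have [[E1 E2 per E3] [dv1 dv2 total]] := sextic_relations.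
have l_gt0 : (0 < l)%N by have := prim_order_gt0 gamma_prim; lia.
suff E4 : (6 * cyc 3 0 = l)%N.
  move=> i; rewrite per; have := ltn_pmod i (isT : 0 < 3)%N.
  by case: (i %% 3)%N => [|[|[|]]] //; lia.
have [p p_pr pF] := finPcharP F.
have [n qE] : exists n, #|F| = (p ^ n.+1)%N.
  have := card_pprimeChar pF; case: (logn p _) => [|n] e; last by exists n.
  by have := finNzRing_gt1 F; rewrite e.
have q_gt1 := finNzRing_gt1 F; have p_gt1 := prime_gt1 p_pr.
have p_neq2 : p != 2%N.
  by apply: contraNneq two_neq0 => p2; rewrite -p2 (pcharf0 pF).
have p_odd : odd p by have := even_prime p_pr; case: odd => //; lia.
have p_neq3 : p != 3%N.
  apply/eqP => p3; have : (3 %| #|F|)%N by rewrite qE p3 expnS dvdn_mulr.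
  by lia.
have p_mod3 : (p %% 3 = 1 \/ p %% 3 = 2)%N.
  have : ~~ (3 %| p)%N by rewrite dvdn_prime2 // eq_sym.
  by lia.
case: p_mod3 => p_mod3; last first.
  have n_even : ~~ odd n.+1.
    by have := expn_mod3 n.+1 p_mod3; rewrite -qE; case: odd => //; lia.
  have [m mE] : exists m, n.+1 = (m * 2)%N by exists (n.+1./2); lia.
  case: (@even_exp_neq_1_3sqr p m `|a|%N p_odd p_mod3); first by lia.
  rewrite -expnM -mE -qE; apply/eqP; rewrite -eqz_nat qa PoszD PoszM.
  by rewrite -abszX gez0_abs ?sqr_ge0 // addrC.
(* A primitive cube root of unity in [F], chosen so that its cubic character is [x -> x^(4 l)]. *)
pose w := gamma ^+ (4 * l).
have w3 : w ^+ 3 = 1.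
  rewrite -exprM (_ : 4 * l * 3 = #|F|.-1 * 2)%N; last by rewrite cardF; ring.
  by rewrite exprM (prim_expr_order gamma_prim) expr1n.
have w1 : w != 1 by rewrite -(prim_order_dvd gamma_prim) cardF gtnNdvd; lia.
case/dvdnP: dv1 => u uE; case/dvdnP: dv2 => v vE.
have norm := cubic_jacobi_norm erefl erefl erefl.
(* The coefficients of J at a complex [w] and at [w^2] are [6 u] and [6 v]; as
   [2 w = - 1 + sqrt(-3)], this is J = c + d sqrt(-3). *)
set c := (cls_quad 0 + cls_quad 3)%N%:Z - 3 * (u%:Z + v%:Z).
set d := 3 * (u%:Z - v%:Z).
have {norm} cd : c ^+ 2 + 3 * d ^+ 2 = 1 + 3 * a ^+ 2.
  rewrite -qa; move: norm; rewrite uE vE /c /d !PoszM => norm.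
  move: norm; move: (cls_quad 0 + cls_quad 3)%N%:Z u%:Z v%:Z => n0 x y norm.
  have -> : #|F|%:Z = n0 ^+ 2 + (x * 6) ^+ 2 + (y * 6) ^+ 2
      - (n0 * (x * 6) + (x * 6) * (y * 6) + (y * 6) * n0).
    by rewrite norm; ring.
  by ring.
have c2 : c ^+ 2 = 1.
  apply: (@sqr_form_unique p n.+1 a c d) => //.
    by rewrite ltn_neqAle eq_sym p_neq2.
    by rewrite -qE.
  (* If n0, n1, n2 are the coefficients of J, then n1 - n2 = 2 d and n0 - n1 = c - d would vanish in
     [F], and J would reduce to n1 (1 + w + w^2) = 0. *)
  apply/negP => /andP[p_c p_d].
  have := quad_power_sum_neq0 pF qE p_mod3; apply/negP; rewrite negbK.
  have w_sum : 1 + w + w ^+ 2 = 0.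
    apply: (mulfI (_ : w - 1 != 0)); first by rewrite subr_eq0.
    have -> : (w - 1) * (1 + w + w ^+ 2) = w ^+ 3 - 1 by ring.
    by rewrite w3 subrr mulr0.
  have -> : \sum_x ((x : F) * (1 - x)) ^+ (4 * l) =
      \sum_x cubic_char w (x * (1 - x)).
    apply: eq_bigr => x _; rewrite /cubic_char; case: eqVneq => [->|x0].
      by rewrite expr0n; case: (l) l_gt0.
    by rewrite -{1}(dlogK x0) exprAC.
  rewrite cubic_char_quad //.
  have intF0 (m : int) : (p %| m)%Z -> m%:~R = 0 :> F.
    by case/dvdzP => k ->; rewrite rmorphM /= -pmulrn (pcharf0 pF) mulr0.
  have u_v : (cls_quad 1 + cls_quad 4)%:R = (cls_quad 2 + cls_quad 5)%:R :> F.
    apply/eqP; rewrite uE vE -subr_eq0; apply/eqP.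
    transitivity ((2 * d)%:~R : F); last by apply: intF0; rewrite dvdz_mull.
    by rewrite /d !(rmorphM, rmorphB) /= ?natrM; ring.
  have n0_u : (cls_quad 0 + cls_quad 3)%:R = (cls_quad 1 + cls_quad 4)%:R :> F.
    apply/eqP; rewrite uE -subr_eq0; apply/eqP.
    transitivity ((c - d)%:~R : F); last by apply: intF0; rewrite rpredB.
    by rewrite /c /d !(rmorphM, rmorphB, rmorphD) /= ?natrM; ring.
  by rewrite n0_u -u_v -[X in X + _ + _]mulr1 -!mulrDr w_sum mulr0.
clear cd qa.
(* [E3] gives [c = -1] modulo 3, which settles the sign. Together with [total] it also yields 2 c =
   3 l - 2 - 18 (3, 0), whence 6 (3, 0) = l. *)
have c_eq : c = -1.
  have /eqP := c2; rewrite sqrf_eq1 => /orP[]/eqP // c1; clear c2.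
  by move: c1 E3; rewrite /c; lia.
clear c2; rewrite !big_ord_recr big_ord0 /= in total.
by move: c_eq; rewrite /c; lia.
Qed.

(** * Counting 2-paths *)

Lemma sum_cls_shift (b : F) (hcyc : forall i, (6 * cyc 3 i = l)%N) :
  (6 * \sum_(j < ell F) cls 3 (b + gamma ^+ (6 * j)) = l * (b != 0%R))%N.
Proof.
rewrite ellE; have [->|b0] := eqVneq b 0.
  by rewrite big1 ?muln0 // => j _; rewrite add0r cls_exp; lia.
rewrite muln1 -[RHS](hcyc (dlog b)); congr (_ * _)%N.
have /= <- := sum_cls0 (fun c => cls 3 (b + c)); rewrite /cyc.
(* For [c] in D_0 put [x = 1 + b / c]: then [x] lies in D_3 exactly when [b + c] does, and
   [1 - x = - b / c] lies in the class of [b]. The count is therefore [cyc 3 (dlog b)]. *)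
have h_inj : injective (fun c : F => 1 + b * c^-1).
  by move=> c d /addrI /(mulfI b0) /invr_inj.
rewrite [RHS](reindex_inj h_inj) /=; apply: eq_bigr => c _.
have [->|c0] := eqVneq c 0.
  by rewrite invr0 mulr0 !addr0 subrr /cls !eqxx !andbF.
have cb : cls (dlog b) b by rewrite /cls b0 eqxx.
have -> : 1 - (1 + b * c^-1) = - (c^-1 * b) by ring.
rewrite clsN (clsM _ cb (_ : 0 + dlog b = dlog b %[mod 6])%N) //.
rewrite (@clsV 0) // [_ && cls 0 c]andbC.
case c_cls: (cls 0 c) => //=; congr nat_of_bool.
have -> : b + c = (1 + b * c^-1) * c by field.
by rewrite (clsM _ c_cls (_ : 3 + 0 = 3 %[mod 6])%N).
Qed.

(** Whether a middle vertex [(y, j)] is reached from [g] depends on [y] alone. For fixed [y], the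
    number of [j] that lead on to [k] is [l / 6], or 0 if [y] is the first coordinate of [k]. The
    factor 6 keeps the identity in the natural numbers. *)
Lemma cay_paths (hcyc : forall i, (6 * cyc 3 i = l)%N) g k :
  (6 * (\sum_h cay_arc gamma g h * cay_arc gamma h k) + l * cay_arc gamma g k
    = l * l)%N.
Proof.
set f := fun y : F => cls 3 (y - g.1 + gamma ^+ (6 * g.2)).
have -> : (\sum_h cay_arc gamma g h * cay_arc gamma h k)%N =
    (\sum_y f y * \sum_(j < ell F) cls 3 (k.1 - y + gamma ^+ (6 * j)))%N.
  under eq_bigr do rewrite !cay_arcE.
  rewrite -(pair_bigA _ (fun (y : F) (j : 'I_(ell F)) =>
    (f y * cls 3 (k.1 - y + gamma ^+ (6 * j)))%N)) /=.
  by apply: eq_bigr => y _; rewrite -big_distrr.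
have -> : (l * l = l * \sum_y f y)%N.
  congr (_ * _)%N; rewrite -[LHS](card_cls 3).
  rewrite [LHS](reindex_inj (addIr (- g.1 + gamma ^+ (6 * g.2)))) /=.
  by apply: eq_bigr => y _; rewrite addrA.
rewrite cay_arcE -/(f k.1) big_distrr /=.
under eq_bigr do rewrite mulnCA sum_cls_shift // subr_eq0 mulnCA.
rewrite -big_distrr -mulnDr /=; congr (_ * _)%N.
rewrite [in RHS](bigD1 k.1) //= [in LHS](bigD1 k.1) //= eqxx muln0 add0n addnC.
by congr (_ + _)%N; apply: eq_bigr => y; rewrite eq_sym => ->; rewrite muln1.
Qed.

End SexticClasses.

(** * The adjacency matrix and the parameters *)

Lemma sum_enum_val (V : finType) (f : V -> nat) :
  (\sum_(i < #|V|) f (enum_val i) = \sum_x f x)%N.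
Proof. by rewrite -big_enum_val. Qed.

Theorem mainTheorem6 (F : finFieldType) (a : int) (gamma : F)
  (hq : (#|F| : int) = 1 + 3 * a ^+ 2)
  (h2 : exists z : F, z != 0 /\ 2%:R = z ^+ 3)
  (hgamma : (#|F|.-1).-primitive_root gamma) :
  let q : rat := (#|F|)%:R in
  is_dsrg (cay_arc gamma)
    (q * (q - 1) / 6)
    (((q - 1) / 6) ^+ 2)
    ((q - 1) ^+ 2 / 216)
    ((q - 1) ^+ 2 / 216 - (q - 1) / 36)
    ((q - 1) ^+ 2 / 216).
Proof.
have q_gt1 := finNzRing_gt1 F.
have q_odd : odd #|F|.
  have [p p_pr pF] := finPcharP F; have cF := card_pprimeChar pF.
  rewrite cF oddX; apply/orP; right.
  have := even_prime p_pr; case: odd => // - [p2|//].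
  by move: (two_neq0 h2); rewrite -p2 (pcharf0 pF) eqxx.
(* As q is odd, [a = 2 b] is even; then q - 1 = 12 b^2, so [l = 2 b^2] is even. *)
have a_even : (2 %| a)%Z.
  apply/negPn/negP => a_odd; have [b bE] : exists b : int, a = 2 * b + 1.
    by exists (a %/ 2)%Z; lia.
  by move: hq; rewrite bE; lia.
case/dvdzP: a_even => b bE.
have [l [cardF l_even]] : exists l, #|F|.-1 = (6 * l)%N /\ ~~ odd l.
  exists (2 * `|b| ^ 2)%N; split; last by lia.
  by move: hq; rewrite bE; lia.
have hcyc := cyc3_eq hgamma cardF l_even h2 hq.
have cF : #|F| = (6 * l + 1)%N by rewrite -cardF addn1 prednK // ltnW.
move=> q; have qE : q = 6 * l%:R + 1 by rewrite /q cF natrD natrM.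
split.
- rewrite card_prod card_ord (ellE cardF) natrM -/q qE.
  by field.
- move=> g; rewrite (cay_arcE hgamma cardF) subrr add0r (cls_exp hgamma cardF).
  by rewrite modnMr.
(* Here t = mu = l^2 / 6 and lambda = mu - l / 6, so the identity matrices cancel and the equation
   reads A^2 = mu J - (l / 6) A, which is [cay_paths] divided by 6. *)
- apply/matrixP => i j; rewrite !mxE.
  under eq_bigr do rewrite !mxE -natrM.
  rewrite -natr_sum (sum_enum_val (fun h =>
    (cay_arc gamma (enum_val i) h * cay_arc gamma h (enum_val j))%N)).
  have := cay_paths hgamma cardF l_even hcyc (enum_val i) (enum_val j).
  move/(congr1 (fun m => m%:R : rat)); rewrite natrD !natrM qE.
  set N := (\sum_h _)%N; set e := cay_arc _ _ _.
  by move=> pathE; case: (i == j); rewrite /= ?mulr1n ?mulr0n; lra.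
- apply/matrixP => i j; rewrite !mxE.
  under eq_bigr do rewrite !mxE mulr1.
  rewrite -natr_sum
    (sum_enum_val (fun h => nat_of_bool (cay_arc gamma (enum_val i) h))).
  have := cay_out_degree hgamma cardF (enum_val i).
  move/(congr1 (fun m => m%:R : rat)); rewrite natrM qE mulr1 => ->.
  by field.
- apply/matrixP => i j; rewrite !mxE.
  under eq_bigr do rewrite !mxE mul1r.
  rewrite -natr_sum
    (sum_enum_val (fun h => nat_of_bool (cay_arc gamma h (enum_val j)))).
  have := cay_in_degree hgamma cardF (enum_val j).
  move/(congr1 (fun m => m%:R : rat)); rewrite natrM qE mulr1 => ->.
  by field.
Qed.
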